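(* Let $p$ be an $n\times n$ non-negative matrix with ${\rm perm}(p)>0$, and let $\beta\in\mathcal{B}_p^{(int)}$ be the (only) interior minimizer over $\mathcal{B}_p$ of the mean-field free energy $$F_{MF}(\beta|p)=\sum_{(i,j)\in\mathcal{E}}\left(\beta_{ij}\log(\beta_{ij}/p_{ij})+(1-\beta_{ij})\log(1-\beta_{ij})\right).$$ Let $Z_{MF}(p)=\exp(-F_{MF}(\beta|p))$. Then $${\rm perm}(p)=Z_{MF}(p)\,{\rm perm}\left(\beta./(1-\beta)\right)\prod_{(i,j)\in\mathcal{E}}(1-\beta_{ij}),$$ where $\beta./(1-\beta)$ denotes the $n\times n$ matrix with entries $\beta_{ij}/(1-\beta_{ij})$.
   Context: ${\rm perm}(p)=\sum_{s\in S_n}\prod_{i=1}^n p_{i s(i)}$. $\mathcal{E}=\{(i,j): p_{ij}>0\}$. $\mathcal{B}_p$ is the set of doubly stochastic non-negative $n\times n$ matrices $\beta$ with $\beta_{ij}=0$ whenever $p_{ij}=0$; $\mathcal{B}_p^{(int)}$ is the set of $\beta\in\mathcal{B}_p$ with $\beta_{ij}\notin\{0,1\}$ for every $(i,j)$ with $p_{ij}\neq0$. *)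

(* Defs.v *)
From HB Require Import structures.
From mathcomp Require Import all_boot all_order all_fingroup all_algebra.
From mathcomp Require Import all_classical all_reals all_analysis.

Set Implicit Arguments.
Unset Strict Implicit.
Unset Printing Implicit Defensive.

Import Order.TTheory GRing.Theory Num.Theory.

Local Open Scope classical_set_scope.
Local Open Scope ring_scope.

Definition permanent (R : realType) (n : nat) (p : 'M[R]_n) : R :=
  \sum_(s : 'S_n) \prod_(i < n) p i (s i).

Definition nonneg_mx (R : realType) (n : nat) (p : 'M[R]_n) : Prop :=
  forall i j, 0 <= p i j.

Definition doubly_stochastic (R : realType) (n : nat) (b : 'M[R]_n) : Prop :=
  [/\ nonneg_mx b,
      forall i, \sum_(j < n) b i j = 1
    & forall j, \sum_(i < n) b i j = 1].

Definition edges (R : realType) (n : nat) (p : 'M[R]_n) :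
    {set 'I_n * 'I_n} :=
  [set e : 'I_n * 'I_n | 0 < p e.1 e.2]%SET.

Definition Bset (R : realType) (n : nat) (p : 'M[R]_n) : set 'M[R]_n :=
  [set b | doubly_stochastic b /\ forall i j, p i j = 0 -> b i j = 0].

Definition Bint (R : realType) (n : nat) (p : 'M[R]_n) : set 'M[R]_n :=
  [set b | Bset p b /\
           forall i j, p i j != 0 -> b i j <> 0 /\ b i j <> 1].

(* On the boundary of [Bset p], the usual convention 0 log 0 = 0 holds
   because [ln 0] is a real number (namely 0). *)
Definition F_MF (R : realType) (n : nat) (p b : 'M[R]_n) : R :=
  \sum_(e in edges p)
    (b e.1 e.2 * ln (b e.1 e.2 / p e.1 e.2)
     + (1 - b e.1 e.2) * ln (1 - b e.1 e.2)).

(* The minimum is over all of [Bset p]; only the minimizer itself is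
   required to be interior. *)
Definition interior_minimizer (R : realType) (n : nat) (p b : 'M[R]_n) : Prop :=
  Bint p b /\ forall b' : 'M[R]_n, Bset p b' -> F_MF p b <= F_MF p b'.

(* Z_MF(p) is the value of this at the interior minimizer [b]. *)
Definition Z_MF (R : realType) (n : nat) (p b : 'M[R]_n) : R :=
  expR (- F_MF p b).

(* The entrywise quotient; for [b] in [Bint p] no denominator vanishes. *)
Definition odds_mx (R : realType) (n : nat) (b : 'M[R]_n) : 'M[R]_n :=
  \matrix_(i < n, j < n) (b i j / (1 - b i j)).

(* Main.v *)
(** At an interior minimizer [b] the gradient of the free energy, with entries
    [g e = ln (b e / (p e * (1 - b e)))], is orthogonal to [c - b] for every
    [c] in [Bset p], since [b + t (c - b)] stays in [Bset p] for small [t] of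
    either sign. Taking for [c] the permutation matrix of any [s] whose graph
    lies in the edge set shows that the sum of [g] along [s] is the constant
    [\sum_e b e * g e]. Hence the [s]-terms of [permanent p] and of
    [permanent (odds_mx b)] have the same ratio for all [s], and this ratio is
    [Z_MF p b * \prod_e (1 - b e)]; all other terms vanish on both sides. *)
Require Import Defs.
From mathcomp Require Import all_boot all_order all_fingroup all_algebra.
From mathcomp Require Import all_classical all_reals all_analysis.
From mathcomp Require Import ring lra.

Set Implicit Arguments.
Unset Strict Implicit.
Unset Printing Implicit Defensive.

Import Order.TTheory GRing.Theory Num.Theory.

Local Open Scope ring_scope.

Lemma is_derive_bigsum (R : numFieldType) (V W : normedModType R) (I : Type)
    (r : seq I) (P : pred I) (h : I -> V -> W) (dh : I -> W) (x v : V) :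
  (forall i, P i -> is_derive x v (h i) (dh i)) ->
  is_derive x v (fun y => \sum_(i <- r | P i) h i y) (\sum_(i <- r | P i) dh i).
Proof.
move=> hdh.
have -> : (fun y => \sum_(i <- r | P i) h i y) = \sum_(i <- r | P i) h i.
  by apply/funext => y; elim/big_rec2: _ => // i f g _ ->.
apply: (big_ind2 (fun f df => is_derive x v f df)) => //.
- exact: is_derive_cst.
- by move=> *; exact: is_deriveD.
Qed.

Lemma doubly_stochastic_le1 (R : realType) (n : nat) (b : 'M[R]_n) i j :
  doubly_stochastic b -> b i j <= 1.
Proof.
case=> b0 br _; rewrite -(br i) (bigD1 j) //= lerDl.
by apply: sumr_ge0 => k _; exact: b0.
Qed.

Lemma doubly_stochastic_perm (R : realType) (n : nat) (s : 'S_n) :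
  doubly_stochastic (perm_mx s : 'M[R]_n).
Proof.
split=> [i j|i|j].
- by rewrite !mxE ler0n.
- rewrite (bigD1 (s i)) //= big1 => [|j jsi]; rewrite !mxE ?eqxx ?addr0 //.
  by rewrite eq_sym (negbTE jsi).
- rewrite (bigD1 ((s^-1)%g j)) //= big1 => [|i isj]; rewrite !mxE.
    by rewrite permKV eqxx addr0.
  by rewrite (canF_eq (permK s)) (negbTE isj).
Qed.

Lemma edges_eq0 (R : realType) (n : nat) (p : 'M[R]_n) e :
  nonneg_mx p -> e \notin edges p -> p e.1 e.2 = 0.
Proof.
by move=> p_ge0; rewrite inE lt_neqAle p_ge0 andbT negbK => /eqP.
Qed.

Lemma Bint_gt0_lt1 (R : realType) (n : nat) (p b : 'M[R]_n) e :
  Bint p b -> e \in edges p -> 0 < b e.1 e.2 < 1.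
Proof.
case=> -[ds _] bint; rewrite inE => /lt0r_neq0 /bint[b0 b1].
rewrite !lt_neqAle doubly_stochastic_le1 // andbT.
case: ds => -> _ _; rewrite andbT eq_sym.
by apply/andP; split; apply/eqP.
Qed.

(** The direction [c - b] has zero row and column sums and vanishes off the edges, so only
    nonnegativity on the edges can fail. It is assumed because [t] may be negative, where convexity
    of [Bset p] gives nothing. *)
Lemma Bset_line (R : realType) (n : nat) (p b c : 'M[R]_n) (t : R) :
  nonneg_mx p -> Bset p b -> Bset p c ->
  (forall e, e \in edges p -> 0 <= b e.1 e.2 + t * (c e.1 e.2 - b e.1 e.2)) ->
  Bset p (\matrix_(i, j) (b i j + t * (c i j - b i j))).
Proof.
move=> p0 [[b0 br bc] bp] [[c0 cr cc] cp] ge0; split; last first.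
  by move=> i j pij; rewrite mxE bp ?cp //; ring.
split=> [i j|i|j].
- rewrite mxE; have [/ge0//|/(edges_eq0 p0) pij] := boolP ((i, j) \in edges p).
  by rewrite bp ?cp //; lra.
- under eq_bigr do rewrite mxE.
  by rewrite big_split /= -mulr_sumr sumrB br cr subrr mulr0 addr0.
- under eq_bigr do rewrite mxE.
  by rewrite big_split /= -mulr_sumr sumrB bc cc subrr mulr0 addr0.
Qed.

Definition grad (R : realType) (n : nat) (p b : 'M[R]_n) (e : 'I_n * 'I_n) : R :=
  ln (b e.1 e.2 / (p e.1 e.2 * (1 - b e.1 e.2))).

(** The product rule gives [ln (x / q) + 1] and [- ln (1 - x) - 1]; the constants cancel, leaving a
    single logarithm. *)
Lemma is_derive_edge_energy (R : realType) (q x : R) :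
  0 < q -> 0 < x < 1 ->
  is_derive x 1 (fun y => y * ln (y / q) + (1 - y) * ln (1 - y))
    (ln (x / (q * (1 - x)))).
Proof.
move=> q0 /andP[x0 x1].
have x1' : 0 < 1 - x by rewrite subr_gt0.
have dq : is_derive x 1 (fun y : R => y / q) q^-1.
  have -> : (fun y : R => y / q) = q^-1 \*: id.
    by apply/funext => y /=; rewrite mulrC.
  by apply: is_derive_eq; rewrite /GRing.scale /= mulr1.
have d1 : is_derive x 1 (fun y : R => 1 - y) (-1).
  by apply: is_derive_eq; rewrite add0r mul1r.
have dlnq := @is_derive1_comp _ _ (fun y => y / q) _ _ _
  (is_derive1_ln (divr_gt0 x0 q0)) dq.
have dln1 := @is_derive1_comp _ _ (fun y => 1 - y) _ _ _
  (is_derive1_ln x1') d1.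
have := is_deriveD (is_deriveM (is_derive_id x 1) dlnq) (is_deriveM d1 dln1).
move=> dphi; apply: (@is_derive_eq _ _ _ _ _ _ _ _ dphi).
rewrite /GRing.scale /= !ln_div ?lnM ?posrE ?mulr_gt0 //.
by field; rewrite !gt_eqF.
Qed.

Lemma is_derive_edge_energy_line (R : realType) (q a d t : R) :
  0 < q -> 0 < a + t * d < 1 ->
  is_derive t 1
    (fun t => (a + t * d) * ln ((a + t * d) / q)
              + (1 - (a + t * d)) * ln (1 - (a + t * d)))
    (d * ln ((a + t * d) / (q * (1 - (a + t * d))))).
Proof.
move=> q0 x01.
have dx : is_derive t 1 (fun t : R => a + t * d) d.
  by apply: is_derive_eq; rewrite scaler0 !add0r mul1r /GRing.scale /= mulr1.
rewrite mulrC.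
exact: (@is_derive1_comp _ _ (fun t => a + t * d) _ _ _
  (is_derive_edge_energy q0 x01) dx).
Qed.

Lemma interior_minimizer_stationary (R : realType) (n : nat)
    (p b c : 'M[R]_n) : nonneg_mx p ->
  interior_minimizer p b -> Bset p c ->
  \sum_(e in edges p) (c e.1 e.2 - b e.1 e.2) * grad p b e = 0.
Proof.
move=> p0 [bint bmin] cB.
have bB : Bset p b by case: bint.
(* For [x] in (0, 1), [x * (1 - x)] is below both [x] and [1 - x], and entries of [c - b] are at
   most 1 in absolute value. Hence a step [t] with [|t| < eps] keeps every edge entry strictly
   between 0 and 1. The default 1 keeps [eps] positive when there are no edges. *)
pose eps := \big[Num.min/1]_(e in edges p) (b e.1 e.2 * (1 - b e.1 e.2)).
have eps0 : 0 < eps.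
  apply/bigmin_gtP; split=> // e eE.
  by have /andP[? ?] := Bint_gt0_lt1 bint eE; rewrite mulr_gt0 // subr_gt0.
have line01 t e : t \in `](- eps), eps[ -> e \in edges p ->
    0 < b e.1 e.2 + t * (c e.1 e.2 - b e.1 e.2) < 1.
  rewrite in_itv /= => /andP[t1 t2] eE.
  have /andP[b0 b1] := Bint_gt0_lt1 bint eE.
  have epsb : eps <= b e.1 e.2 * (1 - b e.1 e.2).
    by apply/bigmin_leP; right; exists e.
  have c0 : 0 <= c e.1 e.2 by case: cB => -[].
  have c1 : c e.1 e.2 <= 1 by case: cB => ds _; exact: doubly_stochastic_le1.
  move: b0 b1 epsb c0 c1; move: (b _ _) (c _ _) => x y b0 b1 epsb c0 c1.
  have : `|t * (y - x)| < x * (1 - x).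
    rewrite normrM; apply: (@le_lt_trans _ _ `|t|).
      by rewrite ler_piMr // ler_norml; lra.
    by apply: lt_le_trans epsb; rewrite ltr_norml t1.
  by rewrite ltr_norml => /andP[l u]; apply/andP; split; nra.
pose f (t : R) := F_MF p (\matrix_(i, j) (b i j + t * (c i j - b i j))).
pose df t : R := \sum_(e in edges p) (c e.1 e.2 - b e.1 e.2)
    * grad p (\matrix_(i, j) (b i j + t * (c i j - b i j))) e.
have dfP t : t \in `](- eps), eps[ -> is_derive t 1 f (df t).
  move=> tE; rewrite /f /df /F_MF; apply: is_derive_bigsum => e eE.
  have q0 : 0 < p e.1 e.2 by move: eE; rewrite inE.
  have := is_derive_edge_energy_line q0 (line01 t e tE eE).
  rewrite /grad mxE; congr is_derive; apply/funext => u.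
  by rewrite mxE.
have line0 : \matrix_(i, j) (b i j + 0 * (c i j - b i j)) = b.
  by apply/matrixP => i j; rewrite mxE mul0r addr0.
have zE : 0 \in `](- eps), eps[ by rewrite in_itv /= oppr_lt0 eps0.
(* By Fermat's rule: 0 is an interior point of the interval, and [f] is minimal there because the
   line stays in [Bset p]. Comparing with the derivative [df 0] gives the claim. *)
have d0 : is_derive (0 : R) 1 f 0.
  apply: (@derive1_at_min _ f (- eps) eps) => //.
  - by lra.
  - by move=> t /dfP[].
  - move=> t tE; rewrite /f line0; apply: bmin; apply: Bset_line => // e eE.
    by have /andP[/ltW] := line01 t e tE eE.
have := dfP 0 zE; rewrite /df line0 => d1.
by rewrite -(@derive_val _ _ _ _ _ _ _ d1) (@derive_val _ _ _ _ _ _ _ d0).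
Qed.

(** All nonzero entries of the permutation matrix lie on edges, so the sum may be extended to all
    pairs; each row then keeps one term. *)
Lemma sum_edges_perm (R : realType) (n : nat) (p : 'M[R]_n) (s : 'S_n)
    (g : 'I_n * 'I_n -> R) : (forall i, (i, s i) \in edges p) ->
  \sum_(e in edges p) (perm_mx s : 'M[R]_n) e.1 e.2 * g e =
  \sum_(i < n) g (i, s i).
Proof.
move=> sE.
transitivity (\sum_(e : 'I_n * 'I_n) (perm_mx s : 'M[R]_n) e.1 e.2 * g e).
  rewrite [LHS]big_mkcond; apply: eq_bigr => -[i j] _.
  case: ifPn => //; rewrite !mxE /=; case: eqP => [<-|_]; last by rewrite mul0r.
  by rewrite sE.
transitivity (\sum_i \sum_j (perm_mx s : 'M[R]_n) i j * g (i, j)).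
  by rewrite pair_bigA; apply: eq_bigr => -[].
apply: eq_bigr => i _; rewrite (bigD1 (s i)) //= big1 => [|j jsi].
  by rewrite !mxE eqxx mul1r addr0.
by rewrite !mxE eq_sym (negbTE jsi) mul0r.
Qed.

(** On each edge, writing [1 - b] as [expR (ln (1 - b))] turns the exponent [- (1 - b) * ln (1 - b)]
    into [b * ln (1 - b)], which joins [- b * ln (b / p)] to form [- b * grad]. *)
Lemma Z_MF_prod (R : realType) (n : nat) (p b : 'M[R]_n) : Bint p b ->
  Z_MF p b * \prod_(e in edges p) (1 - b e.1 e.2) =
  expR (- \sum_(e in edges p) b e.1 e.2 * grad p b e).
Proof.
move=> bint; rewrite /Z_MF /F_MF -!sumrN !expR_sum -big_split /=.
apply: eq_bigr => e eE.
have /andP[b0 b1] := Bint_gt0_lt1 bint eE.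
have b1' : 0 < 1 - b e.1 e.2 by rewrite subr_gt0.
have q0 : 0 < p e.1 e.2 by move: eE; rewrite inE.
rewrite -[X in _ * X]lnK ?posrE // -expRD; congr expR.
by rewrite /grad !ln_div ?lnM ?posrE ?mulr_gt0 //; ring.
Qed.

Theorem mainTheorem2 (R : realType) (n : nat) (p beta : 'M[R]_n)
  (p_ge0 : nonneg_mx p) (perm_gt0 : 0 < permanent p)
  (beta_min : interior_minimizer p beta) :
  permanent p =
    Z_MF p beta * permanent (odds_mx beta)
    * \prod_(e in edges p) (1 - beta e.1 e.2).
Proof.
have bint : Bint p beta by case: beta_min.
have [_ beta_supp] : Bset p beta by case: bint.
rewrite mulrAC Z_MF_prod // /permanent mulr_sumr; apply: eq_bigr => s _.
have [/forallP sE|] := boolP [forall i, (i, s i) \in edges p]; last first.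
  rewrite negb_forall => /existsP[i /(edges_eq0 p_ge0) /= pi0].
  rewrite (bigD1 i) //= pi0 mul0r (bigD1 i) //= mxE beta_supp //.
  by rewrite !mul0r mulr0.
have sB : Bset p (perm_mx s).
  split=> [|i j pij]; first exact: doubly_stochastic_perm.
  rewrite !mxE; case: eqP => // sij.
  by have := sE i; rewrite inE /= sij pij ltxx.
have := interior_minimizer_stationary p_ge0 beta_min sB.
under eq_bigr do rewrite mulrBl.
(* Stationarity towards [perm_mx s] replaces the [s]-independent exponent by the sum of [grad] along
   [s], so the identity splits into one factor per row. *)
rewrite sumrB sum_edges_perm // => /subr0_eq <-.
rewrite -sumrN expR_sum -big_split /=; apply: eq_bigr => i _.
have /andP[b0 b1] := Bint_gt0_lt1 bint (sE i).
have b1' : 0 < 1 - beta i (s i) by rewrite subr_gt0.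
have q0 : 0 < p i (s i) by have := sE i; rewrite inE.
(* The factor [p * (1 - beta) / beta] from the exponential cancels the odds [beta / (1 - beta)],
   leaving [p]. *)
rewrite /grad /= mxE expRN lnK ?posrE ?divr_gt0 ?mulr_gt0 //.
by field; rewrite !gt_eqF.
Qed.
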